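(* For every odd integer $n\geq 3$ and every positive even integer $k$ with $k<n$, \[ \tilde{S}(n,k)=\frac{1}{2}\sum_{h=0}^{(n-k-1)/2}R(h)\binom{k+2h}{k-1}\tilde{S}(n,k+2h+1). \]
   Context: $S(n,k)$ denotes the Stirling number of the second kind, i.e. the number of partitions of an $n$-element set into $k$ pairwise disjoint non-empty subsets, and $\tilde{S}(n,k)=k!\,S(n,k)$. For a non-negative integer $m$, \[ R(m)=\frac{2(2^{2m+2}-1)B_{2m+2}}{m+1}\in\mathbb{Q}, \] where $B_s$ is the $s$th Bernoulli number (so $\frac{z}{e^z-1}=\sum_{s\ge 0}B_s\frac{z^s}{s!}$; e.g. $B_2=1/6$, $B_4=-1/30$). *)

(* Defs.v *)
From HB Require Import structures.
From mathcomp Require Import all_boot all_order all_algebra.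

Set Implicit Arguments.
Unset Strict Implicit.
Unset Printing Implicit Defensive.

Import GRing.Theory Num.Theory.
Local Open Scope ring_scope.

(* [partition] from finset already requires the blocks to be non-empty,
   pairwise disjoint and to cover the whole set. *)
Definition stirling2 (n k : nat) : nat :=
  #|[set P : {set {set 'I_n}} | partition P [set: 'I_n] && (#|P| == k)]|.

Definition stirling2_ord (n k : nat) : nat := (k`! * stirling2 n k)%N.

(* Formal power series over rat are given by their coefficient sequences. *)
Definition fps_mul (a b : nat -> rat) (n : nat) : rat :=
  \sum_(i < n.+1) a i * b (n - i)%N.

Definition fps_X (n : nat) : rat := (n == 1%N)%:R.

(* e^z - 1 *)
Definition fps_expm1 (n : nat) : rat := (n`!%:R)^-1 - (n == 0)%:R.

(* The first n coefficients of the multiplicative inverse of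
   (e^z - 1) / z = \sum_j z^j / (j + 1)!; the coefficient c_m is obtained by
   solving \sum_(i <= m) c_i / (m - i + 1)! = [m = 0]. *)
Fixpoint egf_coefs (n : nat) : seq rat :=
  if n is m.+1 then
    let s := egf_coefs m in
    rcons s ((m == 0)%:R - \sum_(i < m) s`_i / ((m - i).+1)`!%:R)
  else [::].

Definition bernoulli (s : nat) : rat := s`!%:R * (egf_coefs s.+1)`_s.

Definition Rcoef (m : nat) : rat :=
  2%:R * (2%:R ^+ (2 * m + 2) - 1) * bernoulli (2 * m + 2) / (m.+1)%:R.

Lemma size_egf_coefs n : size (egf_coefs n) = n.
Proof. by elim: n => //= n IHn; rewrite size_rcons IHn. Qed.

Lemma nth_egf_coefs n i : (i < n)%N -> (egf_coefs n)`_i = (egf_coefs i.+1)`_i.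
Proof.
elim: n => // n IHn; rewrite ltnS leq_eqVlt => /predU1P[-> // | lt_in].
by rewrite /= nth_rcons size_egf_coefs lt_in IHn.
Qed.

Lemma bernoulli_rec m :
  \sum_(i < m.+1) bernoulli i / i`!%:R / ((m - i).+1)`!%:R = (m == 0)%:R.
Proof.
have bE i : bernoulli i / i`!%:R = (egf_coefs i.+1)`_i.
  by rewrite /bernoulli mulrAC divff ?mul1r // pnatr_eq0 -lt0n fact_gt0.
rewrite big_ord_recr /= bE subnn divr1 [egf_coefs m.+1]/=.
rewrite nth_rcons size_egf_coefs ltnn eqxx.
rewrite (eq_bigr (fun i : 'I_m => (egf_coefs m)`_i / ((m - i).+1)`!%:R)).
  by rewrite addrCA subrr addr0.
by move=> i _; rewrite bE -(nth_egf_coefs (ltn_ord i)).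
Qed.

(* z / (e^z - 1) = \sum_s B_s z^s / s! *)
Lemma bernoulli_egf :
  fps_mul (fun s => bernoulli s / s`!%:R) fps_expm1 =1 fps_X.
Proof.
move=> [|m]; rewrite /fps_mul /fps_expm1 /fps_X.
  by rewrite big_ord_recl big_ord0 /= fact0 invr1 subrr mulr0 addr0.
rewrite big_ord_recr /= subnn fact0 invr1 subrr mulr0 addr0 eqSS.
rewrite -bernoulli_rec; apply: eq_bigr => i _.
by rewrite subSn ?leq_ord //= subr0.
Qed.

Lemma bernoulli_egf_uniq (B : nat -> rat) :
  fps_mul (fun s => B s / s`!%:R) fps_expm1 =1 fps_X -> B =1 bernoulli.
Proof.
move=> defB n; have nzf i : i`!%:R != 0 :> rat by rewrite pnatr_eq0 -lt0n fact_gt0.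
elim/ltn_ind: n => n IHn; have := etrans (defB n.+1) (esym (bernoulli_egf n.+1)).
have e0 : fps_expm1 0 = 0 by rewrite /fps_expm1 fact0 invr1 subrr.
have e1 : fps_expm1 1 = 1 by rewrite /fps_expm1 invr1 subr0.
rewrite /fps_mul !big_ord_recr /= subnn subSnn e0 e1 !mulr0 !addr0 !mulr1.
rewrite (eq_bigr (fun i : 'I_n =>
   bernoulli i / i`!%:R * fps_expm1 (n.+1 - i)%N)) => [|i _]; last by rewrite IHn.
by move/addrI/mulIf; apply; rewrite invr_eq0.
Qed.

Lemma bernoulli_small :
  [/\ bernoulli 0 = 1, bernoulli 1 = - 2%:R^-1, bernoulli 2 = 6%:R^-1
    & bernoulli 4 = - 30%:R^-1].
Proof.
by split; rewrite /bernoulli /= !(big_ord_recl, big_ord0) /=; apply/eqP.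
Qed.

(* Main.v *)
(* Put s_k = k! S(n, k).  Classifying maps by their kernels gives
   m^n = \sum_k s_k C(m, k), which determines the s_k and shows that
   G_n(x) = \sum_k s_(k+1) x^k obeys G_1 = 1, G_(n+1) = (x (x + 1) G_n)'.  Hence
   G_n(-1-x) = (-1)^(n-1) G_n(x).  For odd n this reads G(-x) = exp(-D) G(x)
   with D = d/dx, so that the odd part of G is tanh(D/2) applied to its even
   part; the coefficients of tanh(z/2) are the R(h) / (2 (2h+1)!).  The action
   of power series in D on G becomes a product of power series by setting
   v_i = (n-1-i)! s_(n-i), and then e^z v(-z) = v(z) mod z^n. *)
Require Import Defs.
From mathcomp Require Import all_boot all_order all_algebra.
From mathcomp Require Import ring zify.

Set Implicit Arguments.
Unset Strict Implicit.
Unset Printing Implicit Defensive.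

Import GRing.Theory Num.Theory.
Local Open Scope ring_scope.

(** * Counting maps by their kernels *)

Section Kernels.
Variables T U : finType.

Lemma preim_partition_eqP (rT : eqType) (f : T -> rT) (P : {set {set T}}) :
  partition P [set: T] ->
  reflect (forall x y, (f x == f y) = (y \in pblock P x))
          (preim_partition f [set: T] == P).
Proof.
move=> partP; apply: (iffP eqP) => [<- x y | eq_fP].
  rewrite [RHS](@pblock_equivalence_partition _ (fun x y => f x == f y)) //.
  by split=> // /eqP->.
rewrite -[RHS](equivalence_partition_pblock partP).
by apply: eq_in_imset => x _; apply/setP=> y; rewrite !inE eq_fP.
Qed.

(* A function with kernel P is an injection on the set of blocks of P. *)
Lemma card_preim_partition (P : {set {set T}}) :
  partition P [set: T] ->
  #|[set f : {ffun T -> U} | preim_partition f [set: T] == P]| = (#|U| ^_ #|P|)%N.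
Proof.
move=> partP; have [/eqP covP tiP P0] := and3P partP.
have prP x : pblock P x \in P by rewrite pblock_mem // covP inE.
pose blocks := {B : {set T} | B \in P}.
pose lift (h : {ffun blocks -> U}) :=
  [ffun x => h (exist (fun B => B \in P) (pblock P x) (prP x))].
have reprP (B : blocks) : exists x, x \in val B.
  by apply/set0Pn; apply: contraNneq P0 => <-; apply: valP.
(* A map with kernel [P] is recovered from its values at one representative of each block, which
   inverts [lift]. *)
pose r B := xchoose (reprP B).
have pr B : pblock P (r B) = val B.
  by apply: def_pblock (xchooseP (reprP B)) => //; apply: valP.
have lift_inj : injective lift.
  move=> h1 h2 /ffunP eq_h; apply/ffunP=> B.
  have := eq_h (r B); rewrite !ffunE.
  by congr (h1 _ = h2 _); apply: val_inj; rewrite /= pr.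
have cardD : #|{: blocks}| = #|P| by rewrite card_sig; apply: eq_card.
rewrite -cardD -card_inj_ffuns -(card_imset _ lift_inj).
apply: eq_card => f; rewrite inE; apply/preim_partition_eqP/imsetP => // [kerf|].
  exists [ffun B => f (r B)].
    rewrite inE; apply/injectiveP=> B1 B2; rewrite !ffunE => /eqP.
    by rewrite kerf -eq_pblock ?covP ?inE // !pr => /eqP/val_inj.
  apply/ffunP=> x; rewrite !ffunE; apply/eqP.
  rewrite kerf -eq_pblock ?covP ?inE // pr /=; exact: eqxx.
case=> h; rewrite inE => /injectiveP h_inj -> x y.
by rewrite !ffunE (inj_eq h_inj) -eq_pblock ?covP ?inE.
Qed.

End Kernels.

Lemma expn_sum_stirling2_ord n m :
  (m ^ n = \sum_(k < m.+1) stirling2_ord n k * 'C(m, k))%N.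
Proof.
have := card_ffun 'I_n 'I_m; rewrite !card_ord -sum1_card => <-.
rewrite (partition_big (fun f : {ffun 'I_n -> 'I_m} => preim_partition f [set: 'I_n])
  (fun P => partition P [set: 'I_n])) => [|f _]; last exact: preim_partitionP.
rewrite (eq_bigr (fun P : {set {set 'I_n}} => m ^_ #|P|)%N) => [|P partP]; last first.
  rewrite sum1_card; have := card_preim_partition 'I_m partP.
  rewrite card_ord => <-; by apply: eq_card => f; rewrite !inE.
(* Partitions with more than [m] blocks contribute a vanishing falling factorial; for the others
   [inord #|P|] is faithful. *)
rewrite (bigID (fun P : {set {set 'I_n}} => #|P| < m.+1)%N) /= addnC big1 ?add0n.
  rewrite (partition_big (fun P : {set {set 'I_n}} => inord #|P| : 'I_m.+1) predT) //=.
  apply: eq_bigr => k _.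
  rewrite /stirling2_ord mulnAC -[(_ * 'C(_, _))%N]mulnC bin_ffact mulnC.
  rewrite /stirling2 -sum1dep_card big_distrl /=.
  apply: eq_big => [P|P /andP[/andP[_ ltPm] /eqP <-]]; last by rewrite mul1n inordK.
  rewrite -andbA; congr (_ && _).
  apply/andP/eqP => [[ltPm /eqP <-]|->]; first by rewrite inordK.
  by rewrite ltn_ord; split=> //; apply/eqP/val_inj; rewrite /= inordK.
by move=> P /andP[_]; rewrite -leqNgt => /ffact_small.
Qed.

(** * Newton expansions and geometric polynomials *)

Lemma newton_coef_uniq (a b : nat -> rat) :
  (forall m, \sum_(k < m.+1) a k * 'C(m, k)%:R = \sum_(k < m.+1) b k * 'C(m, k)%:R) ->
  a =1 b.
Proof.
move=> eq_ab; elim/ltn_ind=> m IHm; have := eq_ab m.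
(* The system is triangular, with diagonal entries ['C(m, m)] equal to 1. *)
rewrite !big_ord_recr /= binn !mulr1.
rewrite (eq_bigr (fun i : 'I_m => b i * 'C(m, i)%:R)) => [/addrI //|i _].
by rewrite IHm.
Qed.

(* The quotient by x of the geometric polynomial \sum_k k! S(n + 1, k) x^k. *)
Fixpoint geom_poly (n : nat) : {poly rat} :=
  if n is m.+1 then ('X * ('X + 1) * geom_poly m)^`() else 1.

(** The factor x (x + 1) is invariant under x -> -1 - x, and by the chain rule each derivation
    contributes one sign. *)
Lemma geom_poly_reflect n :
  geom_poly n \Po (- 1 - 'X) = (-1) ^+ n *: geom_poly n.
Proof.
elim: n => [|n IHn]; first by rewrite expr0 scale1r comp_polyC.
pose p := 'X * ('X + 1) * geom_poly n.
have pE : p \Po (- 1 - 'X) = (-1) ^+ n *: p.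
  rewrite /p !rmorphM rmorphD /= comp_polyX comp_polyC IHn -!scalerAr.
  by congr (_ *: _); ring.
have := congr1 deriv pE; rewrite deriv_comp derivZ /= -/p derivB derivX.
rewrite derivN derivC oppr0 add0r mulrN1 => /(congr1 -%R).
by rewrite opprK => ->; rewrite exprS mulN1r scaleNr.
Qed.

Lemma coef_geom_polyS n j :
  (geom_poly n.+1)`_j =
  (if j is i.+1 then (geom_poly n)`_i else 0) *+ j.+1 + (geom_poly n)`_j *+ j.+1.
Proof.
rewrite /= coef_deriv -mulrA coefXM /= mulrDl mul1r coefD coefXM mulrnDl.
by case: j.
Qed.

Lemma size_geom_poly n : (size (geom_poly n) <= n.+1)%N.
Proof.
elim: n => [|n IHn]; first by rewrite size_poly1.
apply/leq_sizeP => j ltnj; rewrite coef_geom_polyS; move/leq_sizeP: IHn => IHn.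
by case: j ltnj => // j ltnj; rewrite !IHn ?mul0rn ?addr0 // ltnW.
Qed.

(** Induction on [n]: m C(m, k+1) = (k+1) C(m, k+1) + (k+2) C(m, k+2), so multiplication by m acts
    on Newton coefficients as the recurrence of [coef_geom_polyS]. *)
Lemma newton_geom_poly n m :
  \sum_(k < m) (geom_poly n)`_k * 'C(m, k.+1)%:R = m%:R ^+ n.+1 :> rat.
Proof.
elim: n => [|n IHn].
  rewrite expr1 /=; case: m => [|m]; first by rewrite big_ord0.
  rewrite big_ord_recl coef1 bin1 mul1r big1 ?addr0 // => i _.
  by rewrite coef1 mul0r.
rewrite exprSr -IHn mulr_suml.
under eq_bigr => k _ do rewrite coef_geom_polyS mulrDl.
rewrite big_split /=; case: m {IHn} => [|m]; first by rewrite !big_ord0 addr0.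
rewrite big_ord_recl mul0rn mul0r add0r addrC.
rewrite [X in _ + X](_ : _ =
    \sum_(k < m.+1) (geom_poly n)`_k * k.+2%:R * 'C(m.+1, k.+2)%:R); last first.
  rewrite big_ord_recr /= [X in _ = _ + X](_ : _ = 0) ?addr0; last first.
    by rewrite bin_small ?mulr0.
  by apply: eq_bigr => k _; rewrite /bump !add1n add0n -[_`_k *+ _]mulr_natr.
rewrite -big_split /=; apply: eq_bigr => k _.
rewrite -[_`_k *+ _]mulr_natr -!mulrA -mulrDr -!natrM -natrD (mul_bin_left _ k.+1).
by rewrite -mulnDl subnKC // mulnC.
Qed.

Lemma coef_geom_poly n k : (geom_poly n)`_k = (stirling2_ord n.+1 k.+1)%:R.
Proof.
(* The shift supplies the missing Newton coefficient at index 0, which is zero; both sequences then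
   expand m^(n+1). *)
have eqS : (fun k => if k is i.+1 then (geom_poly n)`_i else 0) =1
           (fun k => (stirling2_ord n.+1 k)%:R).
  apply: newton_coef_uniq => m; rewrite big_ord_recl /= mul0r add0r.
  rewrite newton_geom_poly -natrX expn_sum_stirling2_ord natr_sum.
  by apply: eq_bigr => i _; rewrite natrM.
exact: (eqS k.+1).
Qed.

Lemma coef_opp1X_exp i j : ((- 1 - 'X : {poly rat}) ^+ i)`_j = (-1) ^+ i * 'C(i, j)%:R.
Proof.
rewrite -opprD -scaleN1r exprZn coefZ exprDn; congr (_ * _).
rewrite (_ : \sum_(k < _) _ = \poly_(k < i.+1) 'C(i, k)%:R).
  by rewrite coef_poly; case: leqP => // ltij; rewrite bin_small.
by rewrite poly_def; apply: eq_bigr => k _; rewrite expr1n mul1r scaler_nat.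
Qed.

Lemma stirling2_ord_reflect n j :
  \sum_(i < n.+1) (stirling2_ord n.+1 i.+1)%:R * (-1) ^+ i * 'C(i, j)%:R =
  (-1) ^+ n * (stirling2_ord n.+1 j.+1)%:R :> rat.
Proof.
have := congr1 (fun p : {poly rat} => p`_j) (geom_poly_reflect n).
rewrite coefZ coef_geom_poly => <-.
rewrite coef_comp_poly (big_ord_widen _
  (fun i => (geom_poly n)`_i * ((- 1 - 'X : {poly rat}) ^+ i)`_j) (size_geom_poly n)).
rewrite [RHS]big_mkcond; apply: eq_bigr => i _ /=.
rewrite -coef_geom_poly -mulrA coef_opp1X_exp; case: ltnP => // ?.
by rewrite nth_default ?mul0r.
Qed.

(** * Truncated power series and tanh(z/2) *)

Definition fps_trunc (M : nat) (a : nat -> rat) : {poly rat} := \poly_(i < M) a i.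

Lemma coef_fps_truncM M a b i :
  (i < M)%N -> (fps_trunc M a * fps_trunc M b)`_i = fps_mul a b i.
Proof.
move=> ltiM; rewrite coefM; apply: eq_bigr => j _.
by rewrite !coef_poly !ifT // (leq_ltn_trans _ ltiM) ?leq_subr // -ltnS.
Qed.

(** An explicit remainder turns congruences modulo ['X^M] into polynomial equations that [ring] can
    combine. *)
Lemma eq_modXn (M : nat) (p q : {poly rat}) :
  (forall i, (i < M)%N -> p`_i = q`_i) -> exists r, p = q + r * 'X^M.
Proof.
move=> eq_pq; exists (drop_poly M (p - q)).
have <- : (p - q) + q = p by rewrite subrK.
rewrite -{1}(poly_take_drop M (p - q)) (_ : take_poly M _ = 0).
  by rewrite addrK add0r addrC.
apply/polyP=> i; rewrite coef_take_poly coefB coef0.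
by case: ifP => // /eq_pq ->; rewrite subrr.
Qed.

Definition fps_exp (n : nat) : rat := n`!%:R^-1.

Lemma fps_mul_exp n : fps_mul fps_exp fps_exp n = 2%:R ^+ n * fps_exp n.
Proof.
have nzf i : i`!%:R != 0 :> rat by rewrite pnatr_eq0 -lt0n fact_gt0.
rewrite -[2%:R]/(1 + 1 : rat) exprDn mulr_suml; apply: eq_bigr => i _.
rewrite !expr1n mulr1 /fps_exp -(bin_fact (ltn_ord i : (i <= n)%N)).
rewrite !natrM; field; rewrite !nzf pnatr_eq0 -lt0n bin_gt0 /=.
by rewrite -ltnS.
Qed.

(* The power series of tanh(z/2) - 1 = -2 / (e^z + 1). *)
Definition tanh1 (m : nat) : rat :=
  2%:R * (2%:R ^+ m.+1 - 1) * (bernoulli m.+1 / m.+1`!%:R).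

Lemma tanh1_Rcoef h : tanh1 (2 * h + 1) = 2%:R^-1 * Rcoef h / (2 * h + 1)`!%:R.
Proof.
rewrite /tanh1 /Rcoef (addnS _ 1) factS natrM.
have -> : (2 * h + 1).+1%:R = 2%:R * h.+1%:R :> rat by rewrite -natrM; congr _%:R; lia.
by field; rewrite nat1r !pnatr_eq0 -lt0n fact_gt0.
Qed.

(* From b(z)(e^z - 1) = z and z tanh1(z) = 2(b(2z) - b(z)); multiplying by
   b(z)(e^z - 1) = z instead of dividing by e^z - 1 costs two orders of
   truncation. *)
Lemma tanh1M_exp1 M i : (i < M)%N ->
  (fps_trunc M tanh1 * (fps_trunc M fps_exp + 1))`_i = (i == 0)%:R *- 2.
Proof.
move=> ltiM; pose K := M.+2; pose Y : {poly rat} := 'X^K.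
pose bern s := bernoulli s / s`!%:R.
pose b := fps_trunc K bern.
(* [b2] and [E2] are the truncations of b(2z) and e^(2z). *)
pose b2 := fps_trunc K (fun s => 2%:R ^+ s * bern s).
pose E := fps_trunc K fps_exp.
pose E2 := fps_trunc K (fun s => 2%:R ^+ s * fps_exp s).
pose A := fps_trunc K tanh1.
have E1 : E - 1 = fps_trunc K fps_expm1.
  apply/polyP=> j; rewrite coefB !coef_poly coef1 /fps_expm1 /fps_exp.
  by case: j => [|j] //=; rewrite !subr0.
have E21 : E2 - 1 = fps_trunc K (fun s => 2%:R ^+ s * fps_expm1 s).
  apply/polyP=> j; rewrite coefB !coef_poly coef1 /fps_expm1 /fps_exp.
  by case: j => [|j] /=; rewrite ?expr0 ?mul1r // !subr0.
have [r1 h1] : exists r, b * (E - 1) = 'X + r * Y.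
  apply: eq_modXn => j ltjK; rewrite E1 coef_fps_truncM // bernoulli_egf.
  by rewrite coefX.
have [r2 h2] : exists r, b2 * (E2 - 1) = 2%:R * 'X + r * Y.
  apply: eq_modXn => j ltjK; rewrite E21 coef_fps_truncM //.
  rewrite mulr_natl coefMn coefX -mulr_natl.
  transitivity (2%:R ^+ j * fps_X j); last first.
    by rewrite /fps_X; case: eqP => [->|]; rewrite ?mulr0.
  rewrite -bernoulli_egf mulr_sumr; apply: eq_bigr => l _.
  by rewrite mulrACA -exprD subnKC // -ltnS.
have [r3 h3] : exists r, E * E = E2 + r * Y.
  by apply: eq_modXn => j ltjK; rewrite coef_fps_truncM // fps_mul_exp coef_poly ltjK.
have [r4 h4] : exists r, 'X * A = 2%:R * (b2 - b) + r * Y.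
  apply: eq_modXn => -[|j] ltjK; rewrite coefXM mulr_natl coefMn coefB !coef_poly ltjK /=.
    by rewrite expr0 mul1r subrr mul0rn.
  by rewrite ltnW // /tanh1 -/(bern _) -mulr_natl; ring.
have [w] : exists w, 'X^2 * (A * (E + 1) + 2%:R) = 'X^2 * (w * 'X^M).
  (* Modulo [Y], X^2 A (E+1) = 2 (b2 - b) (E+1) b (E-1) = 4 b X - 2 b X (E+1) = -2 X b (E-1) = -2
     X^2; the witness collects the multiples of [Y] met on the way. *)
  exists ((E + 1) * 'X * r4 - 2%:R * 'X * r1 - 2%:R * (b2 - b) * (E + 1) * r1
          + 2%:R * b * (r2 + b2 * r3 - r1 * (E + 1))).
  have YE : Y = 'X^2 * 'X^M by rewrite -exprD.
  move/eqP: h1; rewrite -subr_eq0 => /eqP h1.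
  move/eqP: h2; rewrite -subr_eq0 => /eqP h2.
  move/eqP: h3; rewrite -subr_eq0 => /eqP h3.
  move/eqP: h4; rewrite -subr_eq0 => /eqP h4.
  rewrite mulrCA -YE; apply/eqP; rewrite -subr_eq0; apply/eqP.
  transitivity ((E + 1) * 'X * ('X * A - (2%:R * (b2 - b) + r4 * Y))
    - (2%:R * (b2 - b) * (E + 1) + 2%:R * b * (E + 1) + 2%:R * 'X) *
        (b * (E - 1) - ('X + r1 * Y))
    + 2%:R * b * b2 * (E * E - (E2 + r3 * Y))
    + 2%:R * b * (b2 * (E2 - 1) - (2%:R * 'X + r2 * Y))); first by ring.
  by rewrite h1 h2 h3 h4 !mulr0 subrr !addr0.
move/mulfI=> /(_ (expf_neq0 _ (negbT (polyX_eq0 _)))).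
move/(congr1 (fun p : {poly rat} => p`_i)).
rewrite coefMXn ltiM coefD => /eqP; rewrite addr_eq0 => /eqP.
rewrite -[2%:R]polyC_natr coefC => AE.
transitivity ((A * (E + 1))`_i); last by rewrite AE; case: (i == 0)%N; rewrite ?mul0rn ?oppr0.
(* Below degree [M], truncating at [K] or at [M] yields the same coefficients. *)
rewrite !mulrDr !mulr1 !coefD !coef_fps_truncM //; last by lia.
by rewrite !coef_poly ltiM ifT //; lia.
Qed.

(** * From the reflection to the identity *)

Lemma reflected_coef N i : ~~ odd N -> (i <= N)%N ->
  let v m := (N - m)`!%:R * (stirling2_ord N.+1 (N - m).+1)%:R : rat in
  fps_mul (fun m => (-1) ^+ m * v m) fps_exp i = v i.
Proof.
move=> evN leiN v; have := stirling2_ord_reflect N (N - i).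
rewrite -signr_odd (negbTE evN) expr0 mul1r {2}/v => <-.
(* With the index reversed, (N-i)! C(N-m, N-i) = (N-m)! / (i-m)! for m <= i, so the binomial
   transform becomes a product with e^z. *)
rewrite (reindex_inj rev_ord_inj) /= mulr_sumr /fps_mul.
rewrite (big_ord_widen N.+1 (fun m => (-1) ^+ m * v m * fps_exp (i - m))) ?ltnS //.
rewrite big_mkcond; apply: eq_bigr => m _; rewrite subSS ltnS.
have lemN : (m <= N)%N by rewrite -ltnS.
have -> : (-1) ^+ (N - m) = (-1) ^+ m :> rat.
  by rewrite -signr_odd oddB // (negbTE evN) signr_odd.
case: leqP => [lemi|ltim]; last by rewrite bin_small ?mulr0 //; lia.
have leNN : (N - i <= N - m)%N by lia.
rewrite /v /fps_exp -(bin_fact leNN) !natrM.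
have -> : (N - m - (N - i) = i - m)%N by lia.
by field; rewrite pnatr_eq0 -lt0n fact_gt0.
Qed.

(* With v^-(z) = v(-z) and e^z v^- = v, one gets
   tanh1 (v + v^-) = tanh1 (e^z + 1) v^- = -2 v^-. *)
Lemma tanh_convolution (M : nat) (v : nat -> rat) i :
  (forall j, (j < M)%N -> fps_mul (fun m => (-1) ^+ m * v m) fps_exp j = v j) ->
  (i < M)%N -> odd i ->
  v i = \sum_(m < i.+1 | odd m) tanh1 m * v (i - m)%N.
Proof.
move=> vP ltiM oddi; pose vm m := (-1) ^+ m * v m.
pose V := fps_trunc M v; pose W := fps_trunc M vm.
pose E := fps_trunc M fps_exp; pose A := fps_trunc M tanh1.
have [r1 h1] : exists r, W * E = V + r * 'X^M.
  by apply: eq_modXn => j ltj; rewrite coef_fps_truncM // vP // coef_poly ltj.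
have [r2 h2] : exists r, A * (E + 1) = - 2%:R + r * 'X^M.
  apply: eq_modXn => j /tanh1M_exp1 ->; rewrite coefN -[2%:R]polyC_natr coefC.
  by case: j => //=; rewrite mul0rn.
have : A * (V + W) = - 2%:R * W + (r2 * W - A * r1) * 'X^M.
  transitivity (A * (E + 1) * W + A * (V + r1 * 'X^M - W * E) - A * r1 * 'X^M).
    by ring.
  by rewrite h1 h2 subrr mulr0 addr0; ring.
have VWE : V + W = fps_trunc M (fun m => v m + vm m).
  by apply/polyP=> j; rewrite coefD !coef_poly; case: ifP => // _; rewrite addr0.
move/(congr1 (fun p : {poly rat} => p`_i)).
rewrite VWE coef_fps_truncM // coefD coefMXn ltiM addr0 mulNr coefN mulr_natl coefMn.
rewrite coef_poly ltiM /vm -signr_odd oddi expr1 mulN1r mulNrn opprK => sumE.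
have n2 : 2%:R != 0 :> rat by [].
(* Adding [vm] to [v] doubles the even coefficients and kills the odd ones; as [i] is odd, [i - m]
   is even exactly when [m] is odd. *)
apply: (mulIf n2); rewrite mulr_natr -sumE mulr_suml /fps_mul [RHS]big_mkcond.
apply: eq_bigr => m _; rewrite -signr_odd oddB ?oddi; last by rewrite -ltnS.
by case: odd => /=; rewrite ?expr0 ?expr1; ring.
Qed.

Lemma sum_odd_ord (V : nmodType) (F : nat -> V) q :
  \sum_(m < 2 * q.+1 | odd m) F m = \sum_(0 <= h < q.+1) F (2 * h + 1)%N.
Proof.
rewrite big_mkcond; elim: q => [|q IHq].
  by rewrite !big_ord_recl big_ord0 big_nat1 /= add0r addr0.
have -> : (2 * q.+2 = (2 * q.+1).+2)%N by lia.
rewrite [RHS]big_nat_recr //= -{}IHq.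
have : ~~ odd (2 * q.+1) by rewrite mul2n odd_double.
move: (2 * q.+1)%N => p /negbTE evp.
by rewrite 2!big_ord_recr /= evp addr0 addn1.
Qed.

Theorem theorem1p1 (n k : nat) (hn : (3 <= n)%N) (n_odd : odd n)
    (hk : (0 < k)%N) (k_even : ~~ odd k) (hkn : (k < n)%N) :
  (stirling2_ord n k)%:R =
    2%:R^-1 * \sum_(0 <= h < ((n - k - 1) %/ 2).+1)
                Rcoef h * 'C(k + 2 * h, k - 1)%:R
                  * (stirling2_ord n (k + 2 * h + 1))%:R :> rat.
Proof.
case: n n_odd hn hkn => // N oddN _ hkN; set q := ((N.+1 - k - 1) %/ 2)%N.
have nzf i : i`!%:R != 0 :> rat by rewrite pnatr_eq0 -lt0n fact_gt0.
have qE : (N.+1 - k = 2 * q.+1 - 1)%N by rewrite /q; lia.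
(* At index n - k this is (k-1)! times the left-hand side, whence the cancellation of (k-1)!
   below. *)
pose v m : rat := (N - m)`!%:R * (stirling2_ord N.+1 (N - m).+1)%:R.
have vE : v (N.+1 - k)%N =
    \sum_(m < (N.+1 - k).+1 | odd m) tanh1 m * v (N.+1 - k - m)%N.
  apply: (@tanh_convolution N.+1); last 2 first; [by lia | by lia |].
  by move=> j; apply: (@reflected_coef N j oddN).
have {vE} : v (N.+1 - k)%N =
    \sum_(0 <= h < q.+1) tanh1 (2 * h + 1) * v (N.+1 - k - (2 * h + 1))%N.
  rewrite {1}vE -(sum_odd_ord (fun m => tanh1 m * v (N.+1 - k - m)%N)).
  by have -> : (N.+1 - k).+1 = (2 * q.+1)%N by lia.
rewrite /v; have -> : (N - (N.+1 - k) = k - 1)%N by lia.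
have -> : (k - 1).+1 = k by lia.
move=> vE; apply: (mulfI (nzf (k - 1)%N)); rewrite vE !mulr_sumr.
apply: eq_big_nat => h /andP[_ lthq].
have -> : (N - (N.+1 - k - (2 * h + 1)) = k + 2 * h)%N by lia.
rewrite tanh1_Rcoef (addn1 (k + 2 * h)); move: (stirling2_ord _ _)%:R => s.
(* Here (k+2h)! = C(k+2h, k-1) (k-1)! (2h+1)!, and (2h+1)! cancels the denominator of the tanh
   coefficient. *)
have lek : (k - 1 <= k + 2 * h)%N by lia.
rewrite -(bin_fact lek) !natrM.
have -> : (k + 2 * h - (k - 1) = 2 * h + 1)%N by lia.
by field; rewrite nzf.
Qed.
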